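(* Let $d\ge 2$ be an integer, $V=\{1,\dots,d\}$, and let $a,b\in\mathbb{R}^V$ satisfy $0<b_i\le a_i$ for all $i\in V$ and $b_k<a_k$ for at least one $k\in V$. Let $\pi_{ii}=1$ for $i\in V$ and $\pi_{ij}=a_j/b_i$ for $i,j\in V$, $i\ne j$. Let $K_d$ be the solvency cone induced by $\Pi=(\pi_{ij})$ and $K_d^+$ its dual cone. Then $$K_d^+=\operatorname{cone}\{y\in\mathbb{R}^d : (P,N)\text{ is a bipartition of }V,\ y_i=b_i\ \forall i\in P,\ y_j=a_j\ \forall j\in N\},$$ and $$K_d=\Big\{x\in\mathbb{R}^d : \text{for all bipartitions }(P,N)\text{ of }V:\ \sum_{i\in P}b_ix_i+\sum_{j\in N}a_jx_j\ge 0\Big\}.$$ Moreover, $K_d^+$ has at most $2^d-2$ extreme directions.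
   Context: $\operatorname{cone} S$ denotes the set of all finite nonnegative linear combinations of elements of $S$. The solvency cone induced by $\Pi$ is $K_d=\operatorname{cone}\{\pi_{ij}e^i-e^j : (i,j)\in V\times V\}$, where $e^i$ is the $i$-th unit vector of $\mathbb{R}^d$, and $K_d^+=\{y\in\mathbb{R}^d : x^\top y\ge 0 \text{ for all } x\in K_d\}$. A bipartition $(P,N)$ of $V$ is an ordered pair of nonempty disjoint sets with $P\cup N=V$. A vector $y\in K\setminus\{0\}$ is an extreme direction of a polyhedral convex cone $K$ if it belongs to a $1$-dimensional face of $K$; extreme directions that are positive multiples of each other are considered identical (and counted once). *)

(* Defs.v *)
From HB Require Import structures.
From mathcomp Require Import all_boot all_order all_algebra.
From mathcomp Require Import boolp classical_sets functions cardinality.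
From mathcomp Require Import reals convex.

Set Implicit Arguments.
Unset Strict Implicit.
Unset Printing Implicit Defensive.

Import Order.TTheory GRing.Theory Num.Theory.

Local Open Scope classical_set_scope.
Local Open Scope ring_scope.

(* [n = 0] is allowed, so the origin always belongs to [cone S]. *)
Definition cone (R : realType) (d : nat) (S : set 'cV[R]_d) : set 'cV[R]_d :=
  [set x | exists (n : nat) (c : 'I_n -> R) (v : 'I_n -> 'cV[R]_d),
    [/\ forall k, 0 <= c k, forall k, S (v k) & x = \sum_(k < n) c k *: v k]].

(* [delta_mx i 0] is the unit column vector e^i. *)
Definition solvency_cone (R : realType) (d : nat) (Pi : 'M[R]_d) :
    set 'cV[R]_d :=
  cone [set x | exists i j : 'I_d, x = Pi i j *: delta_mx i 0 - delta_mx j 0].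

Definition dual_cone (R : realType) (d : nat) (K : set 'cV[R]_d) :
    set 'cV[R]_d :=
  [set y | forall x, K x -> 0 <= (x^T *m y) 0 0].

Definition bipartition (d : nat) (P N : {set 'I_d}) : Prop :=
  [/\ P <> finset.set0, N <> finset.set0, P :&: N = finset.set0
    & P :|: N = [set: 'I_d]%SET].

(* A face is a convex part F of K such that every segment of K having a
   relative interior point in F has both endpoints in F. *)
Definition face (R : realType) (d : nat) (K F : set 'cV[R]_d) : Prop :=
  [/\ F `<=` K, convex_set (F : set (convex_lmodType 'cV[R]_d))
    & forall (x y : 'cV[R]_d) (t : R), K x -> K y -> 0 < t < 1 ->
        F (t *: x + (1 - t) *: y) -> F x /\ F y].

Definition affine_hull (R : realType) (d : nat) (F : set 'cV[R]_d) :
    set 'cV[R]_d :=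
  [set x | exists (n : nat) (c : 'I_n -> R) (v : 'I_n -> 'cV[R]_d),
    [/\ \sum_(k < n) c k = 1, forall k, F (v k)
      & x = \sum_(k < n) c k *: v k]].

(* The affine hull of F is a translate of a k-dimensional linear subspace;
   this never holds for empty F. *)
Definition has_affine_dim (R : realType) (d : nat) (F : set 'cV[R]_d)
    (k : nat) : Prop :=
  exists (x0 : 'cV[R]_d) (U : {vspace 'cV[R]_d}),
    \dim U = k /\ affine_hull F = [set x | x - x0 \in U].

Definition extreme_direction (R : realType) (d : nat) (K : set 'cV[R]_d)
    (y : 'cV[R]_d) : Prop :=
  [/\ K y, y != 0
    & exists F : set 'cV[R]_d, [/\ face K F, has_affine_dim F 1 & F y]].

(* The extreme directions of K up to positive multiples: each class
   {t y : t > 0} is one element of this set of sets. *)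
Definition extreme_direction_classes (R : realType) (d : nat)
    (K : set 'cV[R]_d) : set (set 'cV[R]_d) :=
  [set r | exists2 y, extreme_direction K y
                    & r = [set z | exists2 t : R, 0 < t & z = t *: y]].

Definition bid_ask_matrix (R : realType) (d : nat) (a b : 'I_d -> R) :
    'M[R]_d :=
  \matrix_(i < d, j < d) (if i == j then 1 else a j / b i).

(* Main.v *)
Require Import Defs.
From HB Require Import structures.
From mathcomp Require Import all_boot all_order all_algebra.
From mathcomp Require Import boolp classical_sets functions cardinality.
From mathcomp Require Import reals convex.
From mathcomp Require Import ring lra.

(** Pairing [y] with the generators of [K] turns membership in the dual cone
into the inequalities [y_j / a_j <= y_i / b_i] for all [i != j]
([dual_solvencyP]).  When [y] is nonnegative, this says that the intervals
[[y_j / a_j, y_j / b_j]] meet pairwise, hence share a point [l].  Then [y]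
lies in [l] times the box [prod_i [b_i, a_i]], so [y] is a nonnegative
combination of corners of the box ([box_cone]).  The corners [a] and [b]
themselves are not allowed, but each of them is a nonnegative combination of
the other corners ([all_corners_in_cone]).  This gives the first equality
([dual_solvencyE]).

That [y] is nonnegative follows from the strict inequality [b_k < a_k]: it makes
the round trip [i -> j -> i] lossy for a suitable [j], which puts each unit
vector in [K] ([unit_in_solvency]).

The second equality ([solvencyE]) is a transport argument.  If [x] pairs
nonnegatively with the corners, consider the one for [P = {i | 0 < x_i}]: the
positive positions are worth [sum_P b_i x_i], which is enough to pay for the
short positions [sum_N a_j |x_j|].  Splitting each short position among the
long ones in proportion to their value [b_i x_i] writes [x] as a combination of
the exchange vectors of [K] plus a vector with nonnegative coordinates.  When
[P] is empty or everything, [x] itself has nonnegative coordinates.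

For the bound, every extreme direction of a generated cone is a positive
multiple of a generator ([extreme_direction_cone]), and there are [2 ^ d - 2]
admissible corners. *)

Set Implicit Arguments.
Unset Strict Implicit.
Unset Printing Implicit Defensive.

Import Order.TTheory GRing.Theory Num.Theory.

Local Open Scope classical_set_scope.
Local Open Scope ring_scope.
Local Open Scope card_scope.

(** * Generated cones and their extreme directions *)

Lemma cone_gen (R : realType) (d : nat) (S : set 'cV[R]_d) (v : 'cV[R]_d) :
  S v -> cone S v.
Proof.
move=> Sv; exists 1%N, (fun=> 1), (fun=> v).
by split=> //; rewrite big_ord1 scale1r.
Qed.

Lemma cone0 (R : realType) (d : nat) (S : set 'cV[R]_d) : cone S 0.
Proof.
by exists 0%N, (fun=> 0), (fun=> 0); split=> // [[]//|]; rewrite big_ord0.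
Qed.

Lemma coneD (R : realType) (d : nat) (S : set 'cV[R]_d) (x y : 'cV[R]_d) :
  cone S x -> cone S y -> cone S (x + y).
Proof.
move=> [n [c [v [c0 Sv ->]]]] [m [e [w [e0 Sw ->]]]].
exists (n + m)%N,
  (fun k => match fintype.split k with inl i => c i | inr j => e j end),
  (fun k => match fintype.split k with inl i => v i | inr j => w j end).
split=> [k|k|]; try by case: (fintype.split k).
rewrite big_split_ord /=; congr (_ + _); apply: eq_bigr => k _.
  by rewrite (unsplitK (inl k)).
by rewrite (unsplitK (inr k)).
Qed.

Lemma coneZ (R : realType) (d : nat) (S : set 'cV[R]_d) (t : R)
    (x : 'cV[R]_d) :
  0 <= t -> cone S x -> cone S (t *: x).
Proof.
move=> t0 [n [c [v [c0 Sv ->]]]].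
exists n, (fun k => t * c k), v; split=> // [k|]; first exact: mulr_ge0.
by rewrite scaler_sumr; apply: eq_bigr => k _; rewrite scalerA.
Qed.

Lemma cone_sum (R : realType) (d : nat) (S : set 'cV[R]_d) (I : finType)
    (P : pred I) (F : I -> 'cV[R]_d) :
  (forall i, P i -> cone S (F i)) -> cone S (\sum_(i | P i) F i).
Proof.
by move=> SF; apply: big_ind => //; [exact: cone0 | move=> x y; exact: coneD].
Qed.

Lemma dual_coneE (R : realType) (d : nat) (S : set 'cV[R]_d) :
  dual_cone (cone S) = [set y | forall x, S x -> 0 <= (x^T *m y) 0 0].
Proof.
apply/seteqP; split=> y /= Hy x; first by move=> Sx; apply/Hy/cone_gen.
move=> [n [c [v [c0 Sv ->]]]].
rewrite linear_sum mulmx_suml summxE; apply: sumr_ge0 => k _.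
by rewrite linearZ -scalemxAl mxE; apply/mulr_ge0/Hy.
Qed.

(** Write [y] as a sum of terms
[c k *: v k].  Each term, being a summand of [y], stays in the face and so in
the line spanned by [y], say equal to [m k *: y].  Since the [m k] sum to 1,
one of them is positive, and that [v k] is a positive multiple of [y]. *)
Lemma extreme_direction_cone (R : realType) (d : nat) (S : set 'cV[R]_d)
    (y : 'cV[R]_d) :
  extreme_direction (cone S) y ->
  exists2 v, S v & exists2 t : R, 0 < t & y = t *: v.
Proof.
move=> [Ky y0 [F [[FK _ Fface] [x0 [U [dimU affF]]] Fy]]].
have FU z : F z -> z - x0 \in U.
  move=> Fz; suff: affine_hull F z by rewrite affF.
  exists 1%N, (fun=> 1), (fun=> z).
  by split=> //; rewrite big_ord1 // scale1r.
(* A sum of two points of the cone is the midpoint of their doubles. *)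
have mid z w : cone S z -> cone S w -> y = z + w -> F (2 *: z) /\ F (2 *: w).
  move=> Kz Kw yE; apply: (Fface _ _ (2^-1)).
  - exact: coneZ.
  - exact: coneZ.
  - by lra.
  rewrite (_ : 1 - 2^-1 = 2^-1 :> R); last by lra.
  by rewrite !scalerA mulVf ?pnatr_eq0// !scale1r -yE.
have F0 : F 0.
  by have [] := mid 0 y (cone0 S) Ky (esym (add0r y)); rewrite scaler0.
have inU z : F z -> z \in U.
  move=> /FU Fz; have := FU _ F0; rewrite sub0r => Fx0.
  by have := rpredB Fz Fx0; rewrite opprK subrK.
have UE : U = <[y]>%VS.
  apply/esym/eqP; rewrite eqEdim dim_vline y0 dimU leqnn andbT.
  by rewrite -memvE; exact: inU.
case: (Ky) => n [c [v [c0 Sv yE]]].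
have mul k : exists m, c k *: v k = m *: y.
  have Kk : cone S (c k *: v k) by apply/coneZ/cone_gen.
  have Kr : cone S (\sum_(i < n | i != k) c i *: v i).
    by apply: cone_sum => i _; apply/coneZ/cone_gen.
  have [|+ _] := mid _ _ Kk Kr; first by rewrite yE (bigD1 k).
  move=> /inU; rewrite UE => /vlineP [m mE]; exists (2^-1 * m).
  by rewrite -scalerA -mE scalerA mulVf ?pnatr_eq0// scale1r.
have [m mE] := choice mul.
have sm : \sum_(k < n) m k = 1.
  apply/eqP; rewrite -subr_eq0; have : (\sum_(k < n) m k - 1) *: y == 0.
    rewrite scalerBl scale1r scaler_suml {2}yE subr_eq0.
    by apply/eqP/eq_bigr => k _; rewrite -mE.
  by rewrite scaler_eq0 (negPf y0) orbF.
have [k mk] : exists k, 0 < m k.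
  apply: contrapT => nm; have : \sum_(k < n) m k <= 0.
    apply: sumr_le0 => k _; rewrite leNgt; apply/negP => mk.
    by apply: nm; exists k.
  by rewrite sm; lra.
exists (v k) => //; exists (c k / m k); last first.
  by rewrite mulrC -scalerA mE scalerA mulVf ?scale1r// gt_eqF.
rewrite divr_gt0// lt_def c0 andbT; apply/eqP => ck.
have := mE k; rewrite ck scale0r => /esym/eqP.
by rewrite scaler_eq0 (negPf y0) gt_eqF.
Qed.

(** * Corners of the box *)

Definition corner (R : realType) (d : nat) (a b : 'I_d -> R)
    (P : {set 'I_d}) : 'cV[R]_d :=
  \col_i (if i \in P then b i else a i).

Definition proper_corners (R : realType) (d : nat) (a b : 'I_d -> R) :
    set 'cV[R]_d :=
  [set y | exists P : {set 'I_d},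
     [/\ P != finset.set0, P != [set: 'I_d]%SET & y = corner a b P]].

Lemma bipartitionE (d : nat) (P N : {set 'I_d}) :
  bipartition P N <->
  [/\ P != finset.set0, P != [set: 'I_d]%SET & N = ~: P].
Proof.
split=> [[/eqP P0 /eqP N0 PN PUN]|[P0 PT ->]].
  have NE : N = ~: P.
    apply/setP => i; move/setP/(_ i): PN; move/setP/(_ i): PUN.
    by rewrite !finset.inE; case: (i \in P); case: (i \in N).
  split=> //; apply: contra_neq N0 => PT.
  by rewrite NE PT finset.setCT.
split.
- exact/eqP.
- by move=> CP; move: PT; rewrite -(finset.setCK P) CP finset.setC0 eqxx.
- exact: finset.setICr.
- exact: finset.setUCr.
Qed.

Lemma bipartition_generatorsE (R : realType) (d : nat) (a b : 'I_d -> R) :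
  [set y : 'cV[R]_d | exists P N : {set 'I_d},
     [/\ bipartition P N, (forall i, i \in P -> y i 0 = b i)
       & (forall j, j \in N -> y j 0 = a j)]] = proper_corners a b.
Proof.
apply/seteqP; split=> y /=.
  move=> [P [N [/bipartitionE [P0 PT ->] yP yN]]]; exists P; split=> //.
  apply/matrixP => i j; rewrite mxE ord1; case: ifPn => [/yP//|iP].
  by apply: yN; rewrite finset.inE.
move=> [P [P0 PT ->]]; exists P, (~: P); split; first exact/bipartitionE.
  by move=> i iP; rewrite mxE iP.
by move=> j; rewrite finset.inE mxE => /negPf ->.
Qed.

Lemma corner_pairing (R : realType) (d : nat) (a b : 'I_d -> R)
    (P : {set 'I_d}) (x : 'cV[R]_d) :
  (x^T *m corner a b P) 0 0 =
  \sum_(i in P) b i * x i 0 + \sum_(j in ~: P) a j * x j 0.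
Proof.
rewrite mxE (bigID (mem P)) /=; congr (_ + _).
  by apply: eq_bigr => i iP; rewrite !mxE iP mulrC.
rewrite [RHS](eq_bigl (fun j => j \notin P)) => [|j]; last first.
  by rewrite finset.inE.
by apply: eq_bigr => i /negPf iP; rewrite !mxE iP mulrC.
Qed.

Lemma unit_pairing (R : realType) (d : nat) (y : 'cV[R]_d) (i : 'I_d) :
  ((delta_mx i 0 : 'cV[R]_d)^T *m y) 0 0 = y i 0.
Proof.
rewrite mxE (bigD1 i) //= big1 => [|j ji]; rewrite !mxE ?eqxx ?mul1r ?addr0//.
by rewrite (negPf ji) mul0r.
Qed.

(** Induction on the coordinates that are not yet known to be at an end of
their interval: [y] lies on the segment between the two points obtained by
moving one of them to its two ends. *)
Lemma box_cone (R : realType) (d : nat) (a b : 'I_d -> R)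
    (T : set 'cV[R]_d) (y : 'cV[R]_d) :
  (forall P, cone T (corner a b P)) ->
  (forall i, b i <= y i 0 <= a i) -> cone T y.
Proof.
move=> Tc ybox.
suff H (A : {set 'I_d}) : forall z : 'cV[R]_d,
    (forall i, b i <= z i 0 <= a i) ->
    (forall i, i \notin A -> z i 0 = b i \/ z i 0 = a i) -> cone T z.
  by apply: (H [set: 'I_d]%SET _ ybox) => i; rewrite finset.in_setT.
have [n] := ubnP #|A|; elim: n A => // n IH A; rewrite ltnS => An z zbox zA.
case: (set_0Vmem A) => [A0|[i iA]].
  rewrite (_ : z = corner a b [set i | z i 0 == b i]%SET); first exact: Tc.
  apply/matrixP => i j; rewrite ord1 mxE finset.inE; case: eqP => // zb.
  by case: (zA i); rewrite ?A0 ?finset.in_set0.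
pose upd t : 'cV[R]_d := \col_j (if j == i then t else z j 0).
(* When [a i = b i] the quotient is 0 by convention, which is still a correct
   weight. *)
pose t := (z i 0 - b i) / (a i - b i).
have /andP[bz za] := zbox i; have ba := le_trans bz za.
have updT s : b i <= s <= a i -> s = b i \/ s = a i -> cone T (upd s).
  move=> sbox sE; apply: (IH (A :\ i)%SET).
  - by move: An; rewrite (cardsD1 i) iA.
  - by move=> j; rewrite mxE; case: eqP => [->|_].
  - move=> j; rewrite !finset.inE mxE; case: eqP => [->|_] //=; exact: zA.
have t01 : 0 <= t <= 1.
  rewrite divr_ge0 ?subr_ge0//=.
  have [ab|ab] := eqVneq (a i) (b i); first by rewrite /t ab subrr invr0 mulr0.
  by rewrite ler_pdivrMr ?mul1r ?lerB// subr_gt0 lt_neqAle eq_sym ab.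
have tE : z i 0 = (1 - t) * b i + t * a i.
  have [ab|ab] := eqVneq (a i) (b i); first by rewrite ab in za *; lra.
  by rewrite /t; field; rewrite subr_eq0.
have -> : z = (1 - t) *: upd (b i) + t *: upd (a i).
  apply/matrixP => j k; rewrite ord1 !mxE; case: eqP => [->|_]; first exact: tE.
  by ring.
case/andP: t01 => t0 t1.
by apply: coneD; apply: coneZ; rewrite ?subr_ge0//; apply: updT;
  rewrite ?lexx ?ba//; [left|right].
Qed.

Lemma set1_properT (d : nat) (hd : (2 <= d)%N) (i : 'I_d) :
  [set i]%SET != [set: 'I_d]%SET.
Proof.
apply: contraTneq hd => /(congr1 (fun A : {set _} => #|A|)).
by rewrite cards1 cardsT card_ord => <-.
Qed.

Lemma corner_setC (R : realType) (d : nat) (a b : 'I_d -> R)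
    (P : {set 'I_d}) : corner a b (~: P)%SET = corner b a P.
Proof. by apply/matrixP => i j; rewrite !mxE finset.in_setC if_neg. Qed.

(** Coordinate [j] of [\sum_i c i *: corner a b [set i]] is
[(\sum_i c i) * a j - c j * (a j - b j)]; solving for this to be [a j] gives
these weights.  The other excluded corner of the box, [b], is the same
statement with [a] and [b] exchanged. *)
Lemma corner_set0_sum (R : realType) (d : nat) (a b : 'I_d -> R) :
  let r i := a i / (a i - b i) in
  (forall i, a i != b i) -> \sum_i r i != 1 ->
  corner a b finset.set0 =
  \sum_i (r i / (\sum_i r i - 1)) *: corner a b [set i]%SET.
Proof.
move=> r ab s1; set s := \sum_i r i in s1 *.
apply/matrixP => j k; rewrite summxE mxE finset.in_set0 (bigD1 j) //=.
rewrite !mxE finset.in_set1 eqxx.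
rewrite (eq_bigr (fun i => r i * (a j / (s - 1)))); last first.
  by move=> i ij; rewrite !mxE finset.in_set1 eq_sym (negPf ij) mulrAC mulrA.
rewrite -mulr_suml (_ : \sum_(i | _) r i = s - r j); last first.
  by rewrite /s [in RHS](bigD1 j) //= [r j + _]addrC addrK.
by rewrite /r; field; rewrite !subr_eq0 ab s1.
Qed.

(** If some interval [[b i, a i]] is degenerate, an excluded corner equals the
corner that takes the other end at [i] only; otherwise [corner_set0_sum] applies,
with nonnegative weights: the ratios and their sum less one are both positive
for [a], and both nonpositive for [b]. *)
Lemma all_corners_in_cone (R : realType) (d : nat) (a b : 'I_d -> R)
    (hd : (2 <= d)%N) (hab : forall i, 0 < b i <= a i) (P : {set 'I_d}) :
  cone (proper_corners a b) (corner a b P).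
Proof.
pose i0 : 'I_d := Ordinal (ltnW hd).
have b0 i : 0 < b i by case/andP: (hab i).
have single0 i : [set i]%SET != finset.set0 :> {set 'I_d}.
  by rewrite -cards_eq0 cards1.
have single i : cone (proper_corners a b) (corner a b [set i]%SET).
  by apply: cone_gen; exists [set i]%SET; split=> //; exact: set1_properT.
have cosingle i : cone (proper_corners a b) (corner b a [set i]%SET).
  rewrite -corner_setC; apply: cone_gen; exists (~: [set i])%SET; split=> //.
    apply: contra_neq (set1_properT hd i) => C0.
    by rewrite -(finset.setCK [set i]%SET) C0 finset.setC0.
  apply: contra_neq (single0 i) => C0.
  by rewrite -(finset.setCK [set i]%SET) C0 finset.setCT.
suff [ca cb] : cone (proper_corners a b) (corner a b finset.set0) /\
               cone (proper_corners a b) (corner b a finset.set0).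
  have [->//|P0] := eqVneq P finset.set0.
  have [->|PT] := eqVneq P [set: 'I_d]%SET.
    by rewrite -finset.setC0 corner_setC.
  by apply: cone_gen; exists P.
have [/existsP[i /eqP abi]|/existsPn ab] := boolP [exists i, a i == b i].
  have corner1 (u w : 'I_d -> R) :
      u i = w i -> corner u w finset.set0 = corner u w [set i]%SET.
    move=> uw; apply/matrixP => j k; rewrite !mxE finset.in_set0 finset.in_set1.
    by case: eqP => // ->.
  by rewrite !corner1.
have r0 i : 0 < a i - b i.
  by rewrite subr_gt0 lt_neqAle eq_sym ab; case/andP: (hab i).
split.
- have r1 i : 1 < a i / (a i - b i).
    by rewrite ltr_pdivlMr// mul1r gtrBl.
  have s1 : 1 < \sum_i a i / (a i - b i).
    rewrite (bigD1 i0) //= ltr_wpDr//; apply: sumr_ge0 => i _.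
    by apply: ltW; apply: lt_trans (r1 i).
  rewrite corner_set0_sum//; last by rewrite gt_eqF.
  apply: cone_sum => i _; apply: coneZ => //.
  by rewrite divr_ge0 ?subr_ge0 1?ltW// (lt_trans _ (r1 i)).
- have r1 i : b i / (b i - a i) <= 0.
    by rewrite -opprB invrN mulrN oppr_le0 divr_ge0// ltW.
  have s0 : \sum_i b i / (b i - a i) <= 0 by apply: sumr_le0.
  rewrite corner_set0_sum//; first last.
  + by rewrite lt_eqF// (le_lt_trans s0).
  + by move=> i; rewrite eq_sym.
  apply: cone_sum => i _; apply: coneZ => //.
  by rewrite mulr_le0// invr_le0 subr_le0 (le_trans s0).
Qed.

(** * The dual of the solvency cone *)

Lemma dual_solvencyP (R : realType) (d : nat) (a b : 'I_d -> R)
    (hb : forall i, 0 < b i) (y : 'cV[R]_d) :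
  dual_cone (solvency_cone (bid_ask_matrix a b)) y <->
  forall i j, i != j -> b i * y j 0 <= a j * y i 0.
Proof.
have pair i j (t : R) :
    ((t *: delta_mx i 0 - delta_mx j 0 : 'cV[R]_d)^T *m y) 0 0 =
    t * y i 0 - y j 0.
  rewrite -(unit_pairing y i) -(unit_pairing y j) linearB linearZ /=.
  by rewrite mulmxBl -scalemxAl !mxE.
rewrite /solvency_cone dual_coneE /=; split=> [Hy i j ij|Hy x [i [j ->]]].
  have := Hy _ (ex_intro _ i (ex_intro _ j erefl)).
  rewrite pair mxE (negPf ij) subr_ge0 mulrAC ler_pdivlMr // mulrC.
  by rewrite [b i * _]mulrC [y j 0 * _]mulrC.
rewrite pair mxE; case: eqVneq => [->|ij]; first by rewrite mul1r subrr.
by rewrite subr_ge0 mulrAC ler_pdivlMr // [y j 0 * _]mulrC; exact: Hy.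
Qed.

Lemma corner_bounds (R : realType) (d : nat) (a b : 'I_d -> R)
    (hab : forall i, 0 < b i <= a i) (P : {set 'I_d}) (i : 'I_d) :
  b i <= corner a b P i 0 <= a i.
Proof.
by have /andP[? ?] := hab i; rewrite mxE; case: ifP; rewrite lexx ?andbT.
Qed.

Lemma corner_in_dual (R : realType) (d : nat) (a b : 'I_d -> R)
    (hab : forall i, 0 < b i <= a i) (P : {set 'I_d}) :
  dual_cone (solvency_cone (bid_ask_matrix a b)) (corner a b P).
Proof.
apply/dual_solvencyP => [i|i j _]; first by case/andP: (hab i).
have /andP[bi _] := corner_bounds hab P i.
have /andP[_ aj] := corner_bounds hab P j.
have /andP[bi0 _] := hab i; have /andP[bj0 baj] := hab j.
rewrite mulrC; apply: ler_pM => //.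
- by have /andP[+ _] := corner_bounds hab P j; apply/le_trans/ltW.
- exact: ltW.
Qed.

(** Exchanging [i] into [j] and back multiplies the amount by
[b i * b j / (a i * a j)].  Choosing [j] with [k] among [i], [j] makes this
factor less than one, and the loss is a positive multiple of [e^i] that lies
in the cone. *)
Lemma unit_in_solvency (R : realType) (d : nat) (a b : 'I_d -> R)
    (hd : (2 <= d)%N) (hab : forall i, 0 < b i <= a i)
    (hk : exists k, b k < a k) (i : 'I_d) :
  solvency_cone (bid_ask_matrix a b) (delta_mx i 0).
Proof.
have b0 j : 0 < b j by case/andP: (hab j).
have ba j : b j <= a j by case/andP: (hab j).
have a0 j : 0 < a j by apply: lt_le_trans (ba j).
have [j ij lt_ba] : exists2 j, i != j & b i * b j < a i * a j.
  have [k bak] := hk; have [->|ik] := eqVneq i k; last first.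
    exists k => //.
    by rewrite (le_lt_trans (y := a i * b k)) ?ler_pM2r ?ltr_pM2l.
  have [j kj] : exists j, k != j.
    have : (0 < #|[set~ k]%SET|)%N by rewrite cardsC1 card_ord -subn1 subn_gt0.
    by case/card_gt0P => j; rewrite !finset.inE eq_sym; exists j.
  by exists j => //; rewrite (lt_le_trans (y := a k * b j)) ?ltr_pM2r ?ler_pM2l.
pose v k l : 'cV[R]_d :=
  bid_ask_matrix a b k l *: delta_mx k 0 - delta_mx l 0.
have Kv k l : solvency_cone (bid_ask_matrix a b) (v k l).
  by apply: cone_gen; exists k, l.
have -> : delta_mx i 0 = (a i * b i / (a i * a j - b i * b j)) *:
    (v i j + (b j / a i) *: v j i) :> 'cV[R]_d.
  rewrite /v !mxE (eq_sym j) (negPf ij); apply/matrixP => k l; rewrite !mxE.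
  by field; rewrite subr_eq0 !gt_eqF.
apply: coneZ; first by rewrite divr_ge0 ?subr_ge0 ?mulr_ge0// ltW.
apply: coneD; first exact: Kv.
by apply: coneZ; [rewrite divr_ge0// ltW|exact: Kv].
Qed.

(** The least ratio [y i 0 / b i] is a common point of the intervals
[[y i 0 / a i, y i 0 / b i]]: the dual inequalities place it to the right of
the left end for every [i] other than the minimizer, and nonnegativity of [y]
does so for the minimizer itself. *)
Lemma dual_solvencyE (R : realType) (d : nat) (a b : 'I_d -> R)
    (hd : (2 <= d)%N) (hab : forall i, 0 < b i <= a i)
    (hk : exists k, b k < a k) :
  dual_cone (solvency_cone (bid_ask_matrix a b)) = cone (proper_corners a b).
Proof.
have b0 i : 0 < b i by case/andP: (hab i).
have a0 i : 0 < a i by case/andP: (hab i) => _; exact: lt_le_trans.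
apply/seteqP; split; last first.
  move=> y [n [c [v [c0 Sv ->]]]].
  apply/dual_solvencyP => // i j ij; rewrite !summxE !mulr_sumr.
  apply: ler_sum => k _; have [P [_ _ ->]] := Sv k.
  have scale l : (c k *: corner a b P) l 0 = c k * corner a b P l 0.
    by rewrite mxE.
  rewrite 2!scale mulrCA [leRHS]mulrCA ler_wpM2l//.
  by have /dual_solvencyP := corner_in_dual hab P; apply.
move=> y yK; have /dual_solvencyP := yK => /(_ b0) yD.
have y0 i : 0 <= y i 0.
  by have := yK _ (unit_in_solvency hd hab hk i); rewrite unit_pairing.
pose i0 : 'I_d := Ordinal (ltnW hd).
have [m _ mmin] := arg_minP (fun i => y i 0 / b i) (erefl : xpredT i0).
pose l := y m 0 / b m.
have [l0|l0] := eqVneq l 0.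
  rewrite (_ : y = 0); first exact: cone0.
  have ym : y m 0 = 0.
    by move/eqP: l0; rewrite mulf_eq0 invr_eq0 (gt_eqF (b0 m)) orbF => /eqP.
  apply/matrixP => j k; rewrite ord1 mxE; apply/le_anti; rewrite y0 andbT.
  have [->|mj] := eqVneq j m; first by rewrite ym.
  by have := yD m j; rewrite eq_sym mj ym mulr0 pmulr_rle0// => ->.
have lpos : 0 < l by rewrite lt_neqAle eq_sym l0 divr_ge0// ltW.
rewrite -[y](scalerKV l0); apply: coneZ; first exact: ltW.
apply: box_cone => [P|i]; first exact: all_corners_in_cone.
rewrite mxE mulrC ler_pdivlMr// ler_pdivrMr//; apply/andP; split.
  by rewrite mulrC -ler_pdivlMr// mmin.
rewrite /l mulrA ler_pdivlMr// mulrC.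
have [->|mi] := eqVneq i m; first by rewrite ler_wpM2r//; case/andP: (hab m).
by apply: yD; rewrite eq_sym.
Qed.

(** * The solvency cone *)

Lemma solvencyE (R : realType) (d : nat) (a b : 'I_d -> R)
    (hd : (2 <= d)%N) (hab : forall i, 0 < b i <= a i)
    (hk : exists k, b k < a k) :
  solvency_cone (bid_ask_matrix a b) =
  [set x : 'cV[R]_d | forall P : {set 'I_d},
     P != finset.set0 -> P != [set: 'I_d]%SET ->
     0 <= (x^T *m corner a b P) 0 0].
Proof.
have b0 j : 0 < b j by case/andP: (hab j).
have ba j : b j <= a j by case/andP: (hab j).
have a0 j : 0 < a j by apply: lt_le_trans (ba j).
set K := solvency_cone _.
have Knonneg (x : 'cV[R]_d) : (forall i, 0 <= x i 0) -> K x.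
  move=> x0; rewrite [x]matrix_sum_delta; apply: cone_sum => i _.
  by rewrite big_ord1; apply: coneZ => //; exact: unit_in_solvency.
apply/seteqP; split=> x /=; first by move=> Kx P _ _; exact: corner_in_dual.
move=> xP; pose P := [set i | 0 < x i 0]%SET.
have [PT|PT] := eqVneq P [set: 'I_d]%SET.
  apply: Knonneg => i; apply: ltW; have : i \in P by rewrite PT finset.in_setT.
  by rewrite finset.inE.
pose s := \sum_(i in P) b i * x i 0.
have [P0|P0] := eqVneq P finset.set0.
  have x0 i : x i 0 <= 0.
    have : i \notin P by rewrite P0 finset.in_set0.
    by rewrite finset.inE -leNgt.
  (* The other coordinates contribute a nonpositive amount to the corner
     inequality at [i], so the contribution of [i] itself is nonnegative. *)
  apply: Knonneg => i.
  have := xP [set i]%SET; rewrite -cards_eq0 cards1 => /(_ isT).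
  move=> /(_ (set1_properT hd i)); rewrite corner_pairing big_set1.
  rewrite -(pmulr_rge0 (x i 0) (b0 i)).
  move=> /le_trans; apply; rewrite gerDl; apply: sumr_le0 => j _.
  by rewrite pmulr_rle0.
have s0 : 0 < s.
  have [i iP] := set0Pn _ P0.
  rewrite /s (bigD1 i) //= ltr_wpDr//.
    apply: sumr_ge0 => j /andP[]; rewrite finset.inE => xj _.
    by rewrite mulr_ge0// ltW.
  by move: iP; rewrite finset.inE => xi; rewrite mulr_gt0.
have sge : \sum_(j in ~: P) a j * - x j 0 <= s.
  have := xP P P0 PT; rewrite corner_pairing -/s.
  rewrite -lerBlDl sub0r; under [X in _ -> X <= _]eq_bigr do rewrite mulrN.
  by rewrite sumrN lerNl.
pose v k l : 'cV[R]_d :=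
  bid_ask_matrix a b k l *: delta_mx k 0 - delta_mx l 0.
have Kv k l : K (v k l) by apply: cone_gen; exists k, l.
(* The part of the short position [j] that the long position [i] covers. *)
pose c i j := b i * x i 0 / s * - x j 0.
pose z := \sum_(i in P) \sum_(j in ~: P) c i j *: v i j.
have Kz : K z.
  apply: cone_sum => i; rewrite finset.inE => xi; apply: cone_sum => j.
  rewrite !finset.inE -leNgt => xj; apply: coneZ; last exact: Kv.
  by rewrite mulr_ge0 ?oppr_ge0// divr_ge0 ?mulr_ge0// ltW.
rewrite -(subrK z x); apply: coneD; last exact: Kz.
(* What remains is zero on the short positions, and nonnegative on the long
   ones by [sge]. *)
apply: Knonneg => k; rewrite !mxE subr_ge0 summxE.
under eq_bigr do rewrite summxE.
have [kP|kP] := boolP (k \in P).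
  rewrite (bigD1 k) //= [X in _ + X]big1 ?addr0; last first.
    move=> i /andP[iP ik]; apply: big1 => j jP.
    rewrite !mxE (eq_sym k i) (negPf ik).
    rewrite (_ : (k == j) = false) /= ?mulr0 ?subr0 ?mulr0//.
    by apply: contraTF jP => /eqP <-; rewrite finset.in_setC kP.
  rewrite (eq_bigr (fun j => x k 0 / s * (a j * - x j 0))) => [|j jP].
    rewrite -mulr_sumr mulrAC ler_pdivrMr// ler_wpM2l//.
    by move: kP; rewrite finset.inE => /ltW.
  have kj : (k == j) = false.
    by apply: contraTF jP => /eqP <-; rewrite finset.in_setC kP.
  by rewrite !mxE /c kj !eqxx /=; field; rewrite !gt_eqF.
rewrite (eq_bigr (fun i => b i * x i 0 * (x k 0 / s))) => [|i iP].
  by rewrite -mulr_suml -/s mulrC divfK// gt_eqF.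
have ki : (k == i) = false by apply: contraNF kP => /eqP ->.
rewrite (bigD1 k) ?finset.in_setC//= big1 ?addr0 => [|j /andP[jP jk]].
  by rewrite !mxE ki !eqxx /c /=; field; rewrite gt_eqF.
by rewrite !mxE ki (eq_sym k j) (negPf jk) /= mulr0 subr0 mulr0.
Qed.

(** * Counting the corners *)

Definition proper_sets (d : nat) : {set {set 'I_d}} :=
  [set P : {set 'I_d} | (P != finset.set0) && (P != [set: 'I_d]%SET)]%SET.

Lemma card_proper_sets (d : nat) : (0 < d)%N ->
  #|proper_sets d| = (2 ^ d - 2)%N.
Proof.
move=> d0.
have -> : proper_sets d = (~: [set finset.set0; [set: 'I_d]%SET])%SET.
  by apply/setP => P; rewrite !finset.inE negb_or.
rewrite cardsCs finset.setCK cards2 -cardsT -powersetT card_powerset.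
by rewrite cardsT card_ord eq_sym -cards_eq0 cardsT card_ord -lt0n d0.
Qed.

Theorem corollary17 (R : realType) (d : nat) (a b : 'I_d -> R)
    (hd : (2 <= d)%N)
    (hab : forall i : 'I_d, 0 < b i <= a i)
    (hk : exists k : 'I_d, b k < a k) :
  let K := solvency_cone (bid_ask_matrix a b) in
  [/\ dual_cone K =
        cone [set y : 'cV[R]_d | exists P N : {set 'I_d},
          [/\ bipartition P N, (forall i, i \in P -> y i 0 = b i)
            & (forall j, j \in N -> y j 0 = a j)]],
      K = [set x : 'cV[R]_d | forall P N : {set 'I_d}, bipartition P N ->
             0 <= \sum_(i in P) b i * x i 0 + \sum_(j in N) a j * x j 0]
    & extreme_direction_classes (dual_cone K) #<= `I_(2 ^ d - 2)].
Proof.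
move=> K; rewrite bipartition_generatorsE /K (dual_solvencyE hd hab hk).
split=> //.
  rewrite (solvencyE hd hab hk); apply/seteqP; split=> x /= xP.
    by move=> P N /bipartitionE[P0 PT ->]; rewrite -corner_pairing; exact: xP.
  by move=> P P0 PT; rewrite corner_pairing; apply/xP/bipartitionE.
pose ray n : set 'cV[R]_d :=
  [set z | exists2 t : R, 0 < t &
     z = t *: corner a b (nth finset.set0 (enum (proper_sets d)) n)].
apply: card_le_trans (card_image_le ray `I_(2 ^ d - 2)).
apply: subset_card_le => r [y].
move=> /extreme_direction_cone[_ [P [P0 PT ->]] [t t0 yE]] ->.
have PA : P \in enum (proper_sets d) by rewrite mem_enum finset.inE P0.
exists (index P (enum (proper_sets d))).
  by rewrite /= -(card_proper_sets (ltnW hd)) cardE index_mem.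
rewrite /ray nth_index//; apply/seteqP; split=> z /= [u u0 ->].
  by exists (u / t); rewrite ?divr_gt0// yE scalerA divfK// gt_eqF.
by exists (u * t); rewrite ?mulr_gt0// yE scalerA.
Qed.
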